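(* Let $k\ge 1$ be an integer and let $a_1\ge 1$ and $a_2,\dots,a_n\ge 2$ be integers. Then the number of integer points in $kP_{S(a_1,\ldots,a_n)}$ equals $$u^T \big(A(k,a_1)R\,A(k,a_2)R\cdots A(k,a_n)R\big) u,$$ where $u=(1,1,\ldots,1)^T$ has $k+1$ entries, $R$ is the $(k+1)\times(k+1)$ permutation matrix reversing the order of the coordinates of a vector, and $A(k,a)$ is the $(k+1)\times(k+1)$ matrix with rows and columns indexed by $\{0,\dots,k\}$ and entries $A_{ij}=\binom{a-2+j-i}{j-i}$.
   Context: For lattice paths $U,L$ from $(0,0)$ to $(m,r)$ using unit steps $(1,0),(0,1)$ with $L$ never above $U$, the lattice path matroid $M[U,L]$ is the matroid on $\{1,\dots,r+m\}$ whose bases are the sets of indices of the $(0,1)$-steps of lattice paths from $(0,0)$ to $(m,r)$ never above $U$ and never below $L$. A snake is a connected lattice path matroid with at least two elements whose diagram (region between $U$ and $L$) has no interior lattice points. The snake $S(a_1,\dots,a_n)$ is the one whose diagram, starting from the origin, consists of a horizontal row of $a_1$ unit squares to the right, then a vertical column of $a_2$ unit squares upward, then a horizontal row of $a_3$ squares to the right, and so on up to $a_n$, where the last square counted by each $a_i$ coincides with the first square counted by $a_{i+1}$. $P_M=\mathrm{conv}\{\sum_{i\in B}e_i: B\text{ a basis}\}$ and $kP_M=\{kx:x\in P_M\}$. Binomial conventions: $\binom{n}{s}=0$ for $s<0$, $\binom{n}{0}=1$, $\binom{n}{s}=n(n-1)\cdots(n-s+1)/s!$ for $s>0$. *)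

(* Defs.v *)
From mathcomp Require Import all_boot all_order all_algebra.
From mathcomp Require Import perm.
From mathcomp Require Import boolp classical_sets cardinality reals.
From mathcomp Require Import zify.

Set Implicit Arguments.
Unset Strict Implicit.
Unset Printing Implicit Defensive.
Import Order.TTheory GRing.Theory Num.Theory.

(** A lattice path is encoded by its word of steps: [true] is the step (0,1)
    and [false] is the step (1,0). *)

Definition lattice_path (m r : nat) (P : seq bool) : bool :=
  (count negb P == m) && (count id P == r).

(** Ordinate of the point reached after [i] steps.  A path meets each
    antidiagonal x + y = i once, so the lattice point (x, y) is above P, on P
    or below P according to the comparison of [y] with [height P (x + y)]. *)
Definition height (P : seq bool) (i : nat) : nat := count id (take i P).

Definition never_above (P Q : seq bool) : Prop :=
  forall i : nat, height P i <= height Q i.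

(** The ground set {1, ..., r + m} is shifted to {0, ..., r + m - 1}. *)
Definition lpm_bases (m r : nat) (U L : seq bool) : {set {set 'I_(r + m)}} :=
  [set B | `[< exists P : seq bool,
     [/\ lattice_path m r P, never_above P U, never_above L P
       & B = [set i : 'I_(r + m) | nth false P i]] >]].

(** The unit square [x, x+1] * [y, y+1] lies between U and L iff its upper left
    corner is not above U and its lower right corner is not below L. *)
Definition in_diagram (U L : seq bool) (x y : nat) : bool :=
  (y.+1 <= height U (x + y.+1)) && (height L (x.+1 + y) <= y).

Definition interior_point (U L : seq bool) (x y : nat) : bool :=
  height L (x + y) < y < height U (x + y).

(** Squares are named by their lower left corner. *)
Definition square_line (c : nat * nat) (vertical : bool) (b : nat) :=
  [seq if vertical then (c.1, c.2 + i) else (c.1 + i, c.2) | i <- iota 0 b].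

Fixpoint squares_from (c : nat * nat) (vertical : bool) (a : seq nat) :=
  if a is b :: a' then
    square_line c vertical b
      ++ squares_from (last c (square_line c vertical b)) (~~ vertical) a'
  else [::].

Definition snake_squares (a : seq nat) : seq (nat * nat) :=
  squares_from (0, 0) false a.

(** The moves leading from each square of the snake to the next one. *)
Fixpoint moves_from (vertical : bool) (a : seq nat) : seq bool :=
  if a is b :: a' then nseq b.-1 vertical ++ moves_from (~~ vertical) a'
  else [::].

Definition snake_moves (a : seq nat) : seq bool := moves_from false a.

(** U visits the upper left corners of the successive squares and L their
    lower right corners; [snake_diagramE] below checks that the squares between
    them are exactly [snake_squares a]. *)
Definition snake_upper (a : seq nat) : seq bool :=
  true :: rcons (snake_moves a) false.

Definition snake_lower (a : seq nat) : seq bool :=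
  false :: rcons (snake_moves a) true.

Definition snake_width (a : seq nat) : nat := count negb (snake_upper a).

Definition snake_rank (a : seq nat) : nat := count id (snake_upper a).

Definition snake_bases (a : seq nat) :
    {set {set 'I_(snake_rank a + snake_width a)}} :=
  lpm_bases (snake_width a) (snake_rank a) (snake_upper a) (snake_lower a).

Lemma lattice_path_snake_upper a :
  lattice_path (snake_width a) (snake_rank a) (snake_upper a).
Proof. by rewrite /lattice_path !eqxx. Qed.

Lemma lattice_path_snake_lower a :
  lattice_path (snake_width a) (snake_rank a) (snake_lower a).
Proof.
rewrite /lattice_path /snake_width /snake_rank /snake_upper /snake_lower.
by rewrite /= -!cats1 !count_cat /=; apply/andP; split; apply/eqP; lia.
Qed.

Lemma height_snake_upper a i :
  height (snake_upper a) i.+1 = (height (snake_moves a) i).+1.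
Proof.
rewrite /height /snake_upper /= -cats1 take_cat.
case: ltnP => // h; rewrite count_cat (take_oversize h).
by case: (i - _) => [|j] /=; lia.
Qed.

Lemma height_snake_lower a i :
  height (snake_lower a) i.+1 =
  height (snake_moves a) i + (size (snake_moves a) < i).
Proof.
rewrite /height /snake_lower /= -cats1 take_cat.
case: ltnP => [h|h]; first by rewrite ltnNge (ltnW h) /=; lia.
rewrite count_cat (take_oversize h).
by case: ltnP => h'; case E: (i - _) => [|j] /=; lia.
Qed.

Lemma never_above_snake a : never_above (snake_lower a) (snake_upper a).
Proof.
move=> [|i]; first by rewrite /height !take0.
by rewrite height_snake_upper height_snake_lower; case: (size _ < _); lia.
Qed.

Lemma snake_paths_meet_only_at_ends a i :
  0 < i < snake_rank a + snake_width a ->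
  height (snake_lower a) i < height (snake_upper a) i.
Proof.
case: i => [//|i] /andP[_].
rewrite height_snake_upper height_snake_lower /snake_rank /snake_width.
have := count_predC id (snake_upper a); rewrite (@eq_count _ (predC id) negb) // => ->.
by rewrite /= size_rcons; case: ltnP; lia.
Qed.

Lemma snake_no_interior_point a x y :
  ~~ interior_point (snake_upper a) (snake_lower a) x y.
Proof.
rewrite /interior_point; case: (x + y) => [|i]; first by rewrite /height !take0 ltn0 andbF.
by rewrite height_snake_upper height_snake_lower; case: (size _ < _); lia.
Qed.

Lemma mem_square_line c v b p :
  (p \in square_line c v b) =
  if v then (p.1 == c.1) && (c.2 <= p.2 < c.2 + b)
  else (p.2 == c.2) && (c.1 <= p.1 < c.1 + b).
Proof.
case: p c => x y [x0 y0] /=; apply/mapP/idP => [[i]|].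
  by rewrite mem_iota; case: v => /= h [-> ->]; lia.
case: v => h; [exists (y - y0)|exists (x - x0)]; rewrite ?mem_iota /=; try lia;
  congr pair; lia.
Qed.

Lemma last_square_line c v b : 0 < b ->
  last c (square_line c v b) =
  if v then (c.1, c.2 + b.-1) else (c.1 + b.-1, c.2).
Proof.
by case: b => // b _; rewrite /square_line -[b.+1]addn1 iotaD map_cat last_cat addn1.
Qed.

Lemma mem_squares_from c v a x y : a != [::] -> all (leq 1) a ->
  ((x, y) \in squares_from c v a) =
  [&& c.1 <= x, c.2 <= y, (x - c.1) + (y - c.2) <= size (moves_from v a)
    & y - c.2 == height (moves_from v a) ((x - c.1) + (y - c.2))].
Proof.
elim: a c v => [//|b a IH] c v _ /= /andP[b0 ha].
rewrite mem_cat mem_square_line last_square_line //.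
rewrite size_cat size_nseq /height take_cat size_nseq.
have cn n : count id (nseq n v) = v * n by rewrite count_nseq; case: v.
have tn n : take n (nseq b.-1 v) = nseq (minn n b.-1) v.
  by elim: (b.-1) n => [|m IHm] [|n] //=; rewrite IHm minnSS.
have [a0|an0] := eqVneq a [::].
  rewrite a0 /= in_nil orbF addn0 cats0.
  have -> : (if (x - c.1 + (y - c.2) < b.-1) then take (x - c.1 + (y - c.2)) (nseq b.-1 v)
     else nseq b.-1 v) = take (x - c.1 + (y - c.2)) (nseq b.-1 v).
    by case: ltnP => // h; rewrite take_oversize // size_nseq.
  by rewrite tn cn; case: v {IH cn tn} => /=; lia.
rewrite IH //; move: (moves_from _ _) => w; rewrite /height.
have hw n : count id (take n w) <= n.
  by apply: leq_trans (count_size _ _) _; rewrite size_take; case: ltnP; lia.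
have h0 : take 0 w = [::] by rewrite take0.
case: (ltnP (x - c.1 + (y - c.2)) b.-1) => h.
  by rewrite tn cn; case: v w hw h0 {IH cn tn} => w hw h0 /=; lia.
rewrite count_cat cn.
case: v w hw h0 {IH cn tn} => w hw h0 /=.
- case: (leqP (c.2 + b.-1) y) => hy.
    have -> : x - c.1 + (y - (c.2 + b.-1)) = x - c.1 + (y - c.2) - b.-1 by lia.
    have := hw (x - c.1 + (y - c.2) - b.-1).
    case E : (x - c.1 + (y - c.2) - b.-1) => [|n]; rewrite ?take0 /=; lia.
  by have := hw (x - c.1 + (y - c.2) - b.-1); lia.
- case: (leqP (c.1 + b.-1) x) => hx.
    have -> : x - (c.1 + b.-1) + (y - c.2) = x - c.1 + (y - c.2) - b.-1 by lia.
    have := hw (x - c.1 + (y - c.2) - b.-1).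
    case E : (x - c.1 + (y - c.2) - b.-1) => [|n]; rewrite ?take0 /=; lia.
  by have := hw (x - c.1 + (y - c.2) - b.-1); lia.
Qed.

Lemma snake_diagramE a x y : a != [::] -> all (leq 1) a ->
  in_diagram (snake_upper a) (snake_lower a) x y = ((x, y) \in snake_squares a).
Proof.
move=> a0 ha; rewrite /snake_squares mem_squares_from //= !subn0.
rewrite -/(snake_moves a) /in_diagram addnS addSn height_snake_upper height_snake_lower.
case: (ltnP (size (snake_moves a)) (x + y)) => h; last by lia.
have -> : height (snake_moves a) (x + y) = count id (snake_moves a).
  by rewrite /height take_oversize // ltnW.
by lia.
Qed.

Local Open Scope classical_set_scope.
Local Open Scope ring_scope.

Definition conv_hull (R : realType) (d : nat) (X : set 'rV[R]_d) :
    set 'rV[R]_d :=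
  [set x | exists n (p : 'I_n -> 'rV[R]_d) (w : 'I_n -> R),
     [/\ forall i, X (p i), forall i, 0 <= w i, \sum_(i < n) w i = 1
       & x = \sum_(i < n) w i *: p i]].

Definition matroid_polytope (R : realType) (d : nat) (Bs : {set {set 'I_d}}) :
    set 'rV[R]_d :=
  conv_hull [set \sum_(i in B) delta_mx 0 i | B in [set` Bs]].

Arguments matroid_polytope R {d} Bs.

Definition dilate (R : realType) (d k : nat) (X : set 'rV[R]_d) :
    set 'rV[R]_d :=
  [set k%:R *: x | x in X].

Definition integer_points (R : realType) (d : nat) (X : set 'rV[R]_d) :
    set 'rV[R]_d :=
  X `&` [set x | forall i, x 0 i \is a Num.int].

(** Generalized binomial coefficient, for a possibly negative upper index. *)
Definition gbinom (n s : int) : rat :=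
  match s with
  | Posz t => (\prod_(i < t) (n%:~R - i%:R)) / t`!%:R
  | Negz _ => 0
  end.

Definition snakeA (k a : nat) : 'M[rat]_k.+1 :=
  \matrix_(i, j) gbinom (a%:Z - 2 + j%:Z - i%:Z) (j%:Z - i%:Z).

Definition reversal_mx (k : nat) : 'M[rat]_k.+1 :=
  perm_mx (perm (@rev_ord_inj k.+1)).

Definition ones (k : nat) : 'cV[rat]_k.+1 := const_mx 1.

(* Main.v *)
Require Import Defs.
From mathcomp Require Import all_boot all_order all_algebra.
From mathcomp Require Import perm.
From mathcomp Require Import finmap.
From mathcomp Require Import boolp classical_sets cardinality reals.
From mathcomp Require Import zify ring lra.

Import Order.TTheory GRing.Theory Num.Theory.

(** Let L be the lower path, with partial heights h_L.  An integer vector x is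
    encoded by the excesses tau_i = x_1 + ... + x_i - k h_L(i).  In a dilated
    base polytope of a snake, 0 <= tau_i <= k because the upper path is at most
    one unit above L, tau vanishes at both ends, and 0 <= x_i <= k says that tau
    weakly increases along the horizontal moves of the snake and weakly
    decreases along the vertical ones.  Conversely such a tau is the sum over
    j < k of the indicators [j < tau_i], and h_L(i) + [j < tau_i] are the heights
    of a lattice path between L and U, so x is a sum of k bases.

    These chains are counted by the transfer matrices T (i <= j) and T^T
    (j <= i).  By the hockey-stick identity A(k, a) = T^(a-1), and
    R T = T^T R, so the matrices R switch between the two directions. *)

(** * Chains of values in {0, ..., k} with prescribed directions *)

Definition next_values (k : nat) (b : bool) (x : nat) : seq nat :=
  [seq y <- iota 0 k.+1 | if b then y <= x else x <= y].
Arguments next_values : simpl never.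

Lemma mem_next_values k b x y :
  (y \in next_values k b x) = (y <= k) && (if b then y <= x else x <= y).
Proof. by rewrite mem_filter (mem_iota 0 k.+1) leq0n add0n ltnS andbC. Qed.

Lemma next_values_uniq k b x : uniq (next_values k b x).
Proof. by rewrite filter_uniq // (iota_uniq 0 k.+1). Qed.

(** The letter [true] is a vertical move and imposes a weak decrease. The starting value [x] is not
    listed. *)
Fixpoint chains (k : nat) (w : seq bool) (x : nat) : seq (seq nat) :=
  if w is b :: w' then
    [seq y :: s | y <- next_values k b x, s <- chains k w' y]
  else [:: [::]].

Lemma chains_uniq k w x : uniq (chains k w x).
Proof.
elim: w x => [|b w IH] x //=; apply: allpairs_uniq_dep => //.
  exact: next_values_uniq.
by move=> [y s] [z t] _ _ /= [-> ->].
Qed.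

Lemma mem_chains k w x t : reflect
  [/\ size t = size w, forall i, nth 0 t i <= k
    & forall i, i < size w ->
        if nth false w i then nth 0 (x :: t) i.+1 <= nth 0 (x :: t) i
        else nth 0 (x :: t) i <= nth 0 (x :: t) i.+1]
  (t \in chains k w x).
Proof.
apply: (iffP idP); last first.
  elim: w x t => [|b w IH] x [|y t] // [/= [] // st tk mono].
  apply/allpairsPdep; exists y, t; split=> //.
    by rewrite mem_next_values (tk 0); exact: (mono 0).
  by apply: IH; split=> // i; [exact: (tk i.+1) | exact: (mono i.+1)].
elim: w x t => [|b w IH] x t.
  by rewrite /= inE => /eqP ->; split=> // i; rewrite nth_nil.
move=> /allpairsPdep[y [s [+ /IH[st tk mono] ->]]].
rewrite mem_next_values => /andP[yk xy].
by split=> [|[|i]|[|i]] //=; rewrite ?st //; exact: mono.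
Qed.

(** * Heights and threshold paths *)

Lemma heightS P n : height P n.+1 = height P n + nth false P n.
Proof.
rewrite /height; case: (ltnP n (size P)) => h.
  by rewrite (take_nth false) // -cats1 count_cat /= addn0.
by rewrite !take_oversize ?nth_default ?addn0 // ltnW.
Qed.

Lemma height_size P n : size P <= n -> height P n = count id P.
Proof. by move=> h; rewrite /height take_oversize. Qed.

Lemma size_lattice_path {m r P} : lattice_path m r P -> size P = r + m.
Proof.
by case/andP=> /eqP <- /eqP <-; rewrite -(count_predC id P).
Qed.

(* The path with heights [height L i + (j < tau i)]. *)
Definition threshold_path (L : seq bool) (tau : nat -> nat) (j : nat) : seq bool :=
  mkseq (fun i => if nth false L i then (j < tau i) ==> (j < tau i.+1)
                  else ~~ (j < tau i) && (j < tau i.+1)) (size L).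

(** By monotonicity the indicator [j < tau i] can only switch on along a horizontal step of [L] and
    off along a vertical one, so the shifted height still grows by 0 or 1. *)
Lemma nth_threshold_path L tau j i :
  (forall n, n < size L ->
     if nth false L n then tau n.+1 <= tau n else tau n <= tau n.+1) ->
  i < size L ->
  nth false (threshold_path L tau j) i + (j < tau i) =
  nth false L i + (j < tau i.+1).
Proof.
move=> mono h; have := mono i h; rewrite nth_mkseq //.
by case: (nth _ _ _) => ?; lia.
Qed.

Lemma height_threshold_path L tau j n : tau 0 = 0 ->
  (forall i, i < size L ->
     if nth false L i then tau i.+1 <= tau i else tau i <= tau i.+1) ->
  n <= size L ->
  height (threshold_path L tau j) n = height L n + (j < tau n).
Proof.
move=> tau0 mono; elim: n => [|n IH] h; first by rewrite tau0 /height !take0.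
rewrite !heightS (IH (ltnW h)).
by have := nth_threshold_path L tau j n mono h; lia.
Qed.

Lemma sum_threshold k t : t <= k -> \sum_(j < k) (j < t) = t.
Proof.
elim: k t => [|k IH] t; first by rewrite leqn0 big_ord0 => /eqP.
rewrite leq_eqVlt => /orP[/eqP->|tk].
  rewrite (eq_bigr (fun=> 1)) ?sum_nat_const ?card_ord ?muln1 // => i _.
  by rewrite ltn_ord.
by rewrite big_ord_recr /= IH // ltnNge -ltnS tk addn0.
Qed.

Local Open Scope fset_scope.
Local Open Scope classical_set_scope.
Local Open Scope ring_scope.

(** * Transfer matrices *)

Definition step_mx (k : nat) (b : bool) : 'M[rat]_k.+1 :=
  \matrix_(i, j) (if b then (j <= i)%N else (i <= j)%N)%:R.

Lemma size_chains k w (x : 'I_k.+1) :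
  (size (chains k w x))%:R =
  ((\prod_(b <- w) step_mx k b) *m ones k) x 0 :> rat.
Proof.
elim: w x => [|b w IH] x; first by rewrite big_nil mul1mx mxE.
rewrite big_cons -mulmxE -mulmxA mxE /= size_allpairs_dep sumnE big_map.
rewrite natr_sum /next_values big_filter big_mkcond.
rewrite -[iota 0 k.+1]/(index_iota 0 k.+1) big_mkord.
apply: eq_bigr => y _; rewrite -IH mxE.
by case: ifP => _; rewrite ?mul1r ?mul0r.
Qed.

(** Row 0 of [step_mx k false] is all ones: the leading horizontal step from 0 leaves the first
    value free and supplies the factor u^T. *)
Lemma size_chains0 k w :
  (size (chains k (false :: w) 0))%:R =
  ((ones k)^T *m (\prod_(b <- w) step_mx k b) *m ones k) 0 0 :> rat.
Proof.
rewrite (size_chains k _ ord0) big_cons -mulmxE -!mulmxA !mxE.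
by apply: eq_bigr => j _; rewrite !mxE.
Qed.

Lemma gbinom_nat (n s : nat) : gbinom n%:Z s%:Z = 'C(n, s)%:R.
Proof.
have h : \prod_(i < s) (n%:Z%:~R - i%:R) = (n ^_ s)%:R :> rat.
  elim: s => [|s IH]; first by rewrite big_ord0.
  rewrite big_ord_recr /= IH ffactnSr natrM; case: (leqP s n) => sn.
    by rewrite natrB.
  by rewrite ffact_small // !mul0r.
by rewrite /gbinom h -bin_ffact natrM mulfK // pnatr_eq0 -lt0n fact_gt0.
Qed.

(** Serves the case a = 1, where the upper index is one less than the lower one and A(k, 1) is the
    identity. *)
Lemma gbinom_pred (n : nat) : gbinom (n%:Z - 1) n%:Z = (n == 0%N)%:R.
Proof.
case: n => [|n]; first by rewrite /gbinom big_ord0 divr1.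
by rewrite intS addrC addKr -intS gbinom_nat bin_small.
Qed.

Lemma hockey_stick (c i n : nat) :
  (\sum_(l < n | i <= l) 'C(c + (l - i), l - i) = 'C(c + (n - i), c.+1))%N.
Proof.
rewrite big_mkcond; elim: n => [|n IH].
  by rewrite big_ord0 addn0 bin_small.
rewrite big_ord_recr /= IH; case: leqP => ni.
  rewrite subSn // addnS binS; congr (_ + _)%N.
  by rewrite -[in RHS](bin_sub (leq_addr _ _)) addKn.
by rewrite (eqP ni) (eqP (ltnW ni)) addn0.
Qed.

(** The entry counts weakly increasing chains from i to j with c intermediate values; the induction
    sums over the last of these. *)
Lemma step_mx_exprS k c (i j : 'I_k.+1) :
  (step_mx k false ^+ c.+1) i j =
  if (i <= j)%N then 'C(c + (j - i), j - i)%:R else 0.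
Proof.
elim: c i j => [|c IH] i j.
  by rewrite expr1 mxE add0n binn; case: leqP.
rewrite exprSr -mulmxE mxE.
transitivity ((\sum_(l < k.+1 | (i <= l)%N && (l < j.+1)%N)
    'C(c + (l - i), l - i))%N%:R : rat).
  rewrite natr_sum [RHS]big_mkcond; apply: eq_bigr => l _.
  by rewrite IH mxE ltnS; case: (i <= l)%N; case: (l <= j)%N; rewrite /= ?mul0r ?mulr1 ?mulr0.
rewrite -(big_ord_widen_cond _ (leq i) (fun l => 'C(c + (l - i), l - i))%N (ltn_ord j)).
rewrite hockey_stick; case: leqP => ij.
  by rewrite subSn // addnS -addSn -[in RHS]bin_sub ?leq_addl // addnK.
by rewrite (eqP ij) addn0 bin_small.
Qed.

Lemma snakeA_step_mx k b : (0 < b)%N -> snakeA k b = step_mx k false ^+ b.-1.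
Proof.
move=> b0; apply/matrixP=> i j; rewrite mxE -addrA.
have [ij|ij] := leqP i j; last first.
  (* Below the diagonal the lower index is negative and [gbinom] is 0. *)
  have -> : j%:Z - i%:Z = Negz (i - j).-1 by lia.
  case: b b0 => [//|[|c]] _; first by rewrite expr0 mxE -val_eqE gtn_eqF.
  by rewrite step_mx_exprS leqNgt ij.
rewrite subzn //; case: b b0 => [//|[|c]] _.
  by rewrite expr0 mxE addrC gbinom_pred -val_eqE subn_eq0 eqn_leq ij.
have -> : c.+2%:Z - 2 = c%:Z by lia.
by rewrite -PoszD gbinom_nat step_mx_exprS ij.
Qed.

Lemma reversal_mxE k (i j : 'I_k.+1) :
  reversal_mx k i j = (rev_ord i == j)%:R.
Proof. by rewrite !mxE permE. Qed.

Lemma reversal_mulmx k n (M : 'M[rat]_(k.+1, n)) i j :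
  (reversal_mx k *m M) i j = M (rev_ord i) j.
Proof. by rewrite -row_permE mxE permE. Qed.

Lemma reversal_mxK k : reversal_mx k *m reversal_mx k = 1%:M.
Proof.
by apply/matrixP=> i j; rewrite reversal_mulmx reversal_mxE rev_ordK mxE.
Qed.

Lemma reversal_ones k : reversal_mx k *m ones k = ones k.
Proof. by apply/matrixP=> i j; rewrite reversal_mulmx !mxE. Qed.

(** Reversing {0, ..., k} exchanges <= and >=. As R is symmetric, right multiplication by R becomes
    a row permutation of the transpose. *)
Lemma reversal_step_mx k :
  reversal_mx k *m step_mx k false = step_mx k true *m reversal_mx k.
Proof.
have tr : (reversal_mx k)^T = reversal_mx k.
  by apply/matrixP=> i j; rewrite mxE !reversal_mxE -(inj_eq rev_ord_inj) rev_ordK eq_sym.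
rewrite -[RHS]trmxK trmx_mul tr; apply/matrixP=> i j.
rewrite reversal_mulmx mxE [RHS]mxE reversal_mulmx !mxE /=.
by congr (nat_of_bool _)%:R; have := ltn_ord i; have := ltn_ord j; lia.
Qed.

Lemma reversal_step_mxX k n :
  reversal_mx k *m step_mx k false ^+ n = step_mx k true ^+ n *m reversal_mx k.
Proof.
elim: n => [|n IH]; first by rewrite !expr0 mulmx1 mul1mx.
by rewrite exprSr exprS -!mulmxE mulmxA IH -!mulmxA reversal_step_mx !mulmxA
  !mulmxE -exprS -exprSr.
Qed.

(** The flag [v] records an R pending from the previous block. A horizontal block hands its trailing
    R on to the next block; in a vertical block the pending R transposes T^(b-1) and then cancels
    with the trailing R. An R left at the end is absorbed by u. *)
Lemma prod_snakeA k (v : bool) (a : seq nat) : {in a, forall b, (0 < b)%N} ->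
  (if v then reversal_mx k else 1%:M) *m
    (\prod_(b <- a) (snakeA k b *m reversal_mx k)) *m ones k =
  (\prod_(b <- moves_from v a) step_mx k b) *m ones k.
Proof.
elim: a v => [|b a IH] v ha.
  by rewrite !big_nil mulmx1; case: v; rewrite mul1mx ?reversal_ones.
have b0 : (0 < b)%N by apply: ha; rewrite mem_head.
have {}IH v' := IH v' (fun c ca => ha c (mem_behead (s := b :: a) ca)).
rewrite big_cons big_cat big_nseq iter_mulr_1.
rewrite -!mulmxE in IH *; rewrite -[RHS]mulmxA -IH.
rewrite snakeA_step_mx //; case: v => /=.
  rewrite mul1mx !mulmxA reversal_step_mxX.
  by rewrite -(mulmxA _ (reversal_mx k) (reversal_mx k)) reversal_mxK mulmx1.
by rewrite mul1mx !mulmxA.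
Qed.

Lemma size_snake_chains k a : {in a, forall b, (0 < b)%N} ->
  (size (chains k (false :: snake_moves a) 0))%:R =
  ((ones k)^T *m (\prod_(b <- a) (snakeA k b *m reversal_mx k)) *m ones k) 0 0.
Proof.
move=> /(prod_snakeA k false); rewrite mul1mx => h.
by rewrite size_chains0 -!mulmxA h.
Qed.

(** * Linear inequalities on base polytopes, and prefix sums *)

Lemma conv_hull_bounds {R : realType} {d : nat} (X : set 'rV[R]_d)
    (c : 'I_d -> R) (lo hi : R) :
  (forall p, X p -> lo <= \sum_i c i * p 0 i <= hi) ->
  forall x, conv_hull X x -> lo <= \sum_i c i * x 0 i <= hi.
Proof.
move=> Xb x [n [p [w [Xp w0 w1 ->]]]].
have -> : \sum_i c i * (\sum_j w j *: p j) 0 i =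
          \sum_j w j * \sum_i c i * p j 0 i.
  under eq_bigr => i _ do rewrite summxE mulr_sumr.
  rewrite exchange_big; apply: eq_bigr => j _; rewrite mulr_sumr.
  by apply: eq_bigr => i _; rewrite mxE mulrCA.
(* The weights sum to 1, so the bounds are averages too and can be compared term by term. *)
have cst z : z = \sum_j w j * z by rewrite -mulr_suml w1 mul1r.
by rewrite [lo]cst [hi]cst; apply/andP; split;
  apply: ler_sum => j _; apply: ler_wpM2l => //; case/andP: (Xb _ (Xp j)).
Qed.

(** The indicator is a coefficient, which makes this a linear form as in [conv_hull_bounds]. *)
Definition prefix_sum {R : realType} {d : nat} (x : 'rV[R]_d) (n : nat) : R :=
  \sum_(i < d) (i < n)%:R * x 0 i.

Lemma prefix_sum0 {R : realType} {d : nat} (x : 'rV[R]_d) : prefix_sum x 0 = 0.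
Proof. by apply: big1 => i _; rewrite ltn0 mul0r. Qed.

Lemma sum_coord {R : realType} {d : nat} (x : 'rV[R]_d) (i : 'I_d) :
  \sum_j (j == i)%:R * x 0 j = x 0 i.
Proof.
rewrite (bigD1 i) //= eqxx mul1r big1 ?addr0 // => j /negPf ->.
by rewrite mul0r.
Qed.

Lemma prefix_sumS {R : realType} {d : nat} (x : 'rV[R]_d) (i : 'I_d) :
  prefix_sum x i.+1 = prefix_sum x i + x 0 i.
Proof.
rewrite -[in RHS](sum_coord x i) -big_split; apply: eq_bigr => j _ /=.
rewrite -mulrDl -natrD; congr (_%:R * _); rewrite -val_eqE /=; lia.
Qed.

Lemma prefix_sumZ {R : realType} {d : nat} (c : R) (x : 'rV[R]_d) n :
  prefix_sum (c *: x) n = c * prefix_sum x n.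
Proof.
by rewrite /prefix_sum mulr_sumr; apply: eq_bigr => i _; rewrite mxE mulrCA.
Qed.

Lemma prefix_sum_int {R : realType} {d : nat} (x : 'rV[R]_d) n :
  (forall i, x 0 i \is a Num.int) -> prefix_sum x n \is a Num.int.
Proof.
by move=> xint; apply: rpred_sum => i _; apply: rpredM => //; exact: rpred_nat.
Qed.

Lemma indicator_coord {R : realType} {d : nat} (B : {set 'I_d}) (j : 'I_d) :
  (\sum_(i in B) delta_mx 0 i : 'rV[R]_d) 0 j = (j \in B)%:R.
Proof.
rewrite summxE; under eq_bigr => i _ do rewrite mxE eqxx /=.
rewrite -natr_sum; congr (_%:R); case: (boolP (j \in B)) => jB.
  rewrite (bigD1 j) //= eqxx big1 // => i /andP[_ ij].
  by rewrite eq_sym (negPf ij).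
by rewrite big1 // => i iB; case: eqP => // ji; rewrite ji iB in jB.
Qed.

Lemma prefix_sum_indicator (R : realType) (d : nat) (P : seq bool) n : (n <= d)%N ->
  prefix_sum (\sum_(i in [set i : 'I_d | nth false P i]%SET) delta_mx 0 i : 'rV[R]_d) n
  = (height P n)%:R.
Proof.
elim: n => [|n IH] nd; first by rewrite prefix_sum0 /height take0.
rewrite (prefix_sumS _ (Ordinal nd)) IH; last exact: ltnW.
by rewrite indicator_coord inE heightS natrD.
Qed.

Lemma mem_lpm_bases m r U L B : B \in lpm_bases m r U L <->
  exists P : seq bool, [/\ lattice_path m r P, never_above P U, never_above L P
    & B = [set i : 'I_(r + m) | nth false P i]%SET].
Proof. by rewrite inE; split=> [/asboolP|?]; last exact/asboolP. Qed.

(** At the vertex of a basis the prefix sums are the heights of its path. *)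
Lemma matroid_polytope_prefix_sum {R : realType} {m r U L} {x : 'rV[R]_(r + m)} {n} :
  matroid_polytope R (lpm_bases m r U L) x -> (n <= r + m)%N ->
  (height L n)%:R <= prefix_sum x n <= (height U n)%:R.
Proof.
move=> + nd; apply: conv_hull_bounds => p [B /= /mem_lpm_bases[P [_ PU LP ->]] <-].
by rewrite -/(prefix_sum _ _) prefix_sum_indicator // !ler_nat PU LP.
Qed.

Lemma matroid_polytope_coord {R : realType} {d} {Bs : {set {set 'I_d}}} {x : 'rV[R]_d} i :
  matroid_polytope R Bs x -> 0 <= x 0 i <= 1.
Proof.
rewrite -(sum_coord x i); apply: conv_hull_bounds => p [B _ <-].
by rewrite sum_coord indicator_coord ler0n lern1 leq_b1.
Qed.

(** * Chains as integer points *)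

(* A chain lists the values at the squares only; its value is 0 at both
   endpoints of the paths, the final one through the default of [nth]. *)
Definition chain_value (t : seq nat) (i : nat) : nat := nth 0%N (0%N :: t) i.

(** The point whose excesses over k h_L form the chain. The subtraction is in [R], hence not
    truncated. *)
Definition chain_point (R : realType) (d k : nat) (L : seq bool) (t : seq nat) : 'rV[R]_d :=
  \row_i ((k * nth false L i)%:R + (chain_value t i.+1)%:R - (chain_value t i)%:R).

Lemma prefix_sum_chain_point (R : realType) d k L t n : (n <= d)%N ->
  prefix_sum (chain_point R d k L t) n = (k * height L n + chain_value t n)%:R.
Proof.
elim: n => [|n IH] nd; first by rewrite prefix_sum0 /height take0 muln0.
rewrite (prefix_sumS _ (Ordinal nd)) IH; last exact: ltnW.
by rewrite mxE heightS mulnDr !natrD /=; ring.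
Qed.

(** Prefix sums recover the chain values; the size bound puts every entry within their reach. *)
Lemma chain_point_inj {R : realType} {d k L t1 t2} :
  size t1 = size t2 -> (size t1 <= d)%N ->
  chain_point R d k L t1 = chain_point R d k L t2 -> t1 = t2.
Proof.
move=> s12 s1d e; apply: (@eq_from_nth _ 0%N) => // i i1.
have id := leq_trans i1 s1d.
have := prefix_sum_chain_point R d k L t1 i.+1 id.
rewrite e prefix_sum_chain_point // => /eqP; rewrite eqr_nat => /eqP.
by move/addnI.
Qed.

Lemma size_snake_lower a : size (snake_lower a) = (size (snake_moves a)).+2.
Proof. by rewrite /= size_rcons. Qed.

Lemma snake_size a : (snake_rank a + snake_width a)%N = (size (snake_moves a)).+2.
Proof.
by rewrite -(size_lattice_path (lattice_path_snake_lower a)) size_snake_lower.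
Qed.

(** The word of the chain is [snake_lower a] without its last letter [true]: the last step, down to
    the default value 0, is always a decrease. *)
Lemma mem_snake_chains k a t :
  t \in chains k (false :: snake_moves a) 0 <->
  [/\ size t = (size (snake_moves a)).+1, forall i, (chain_value t i <= k)%N
    & forall i, (i < size (snake_lower a))%N ->
      if nth false (snake_lower a) i then (chain_value t i.+1 <= chain_value t i)%N
      else (chain_value t i <= chain_value t i.+1)%N].
Proof.
have nthL i : (i <= size (snake_moves a))%N ->
    nth false (snake_lower a) i = nth false (false :: snake_moves a) i.
  by move=> h; rewrite /snake_lower -rcons_cons nth_rcons /= ltnS h.
split=> [/mem_chains[st tk mono]|[st tk mono]].
  split=> // [[|i]|i] //; first exact: tk.
  rewrite size_snake_lower ltnS leq_eqVlt => /orP[/eqP ->|h].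
    rewrite /snake_lower -rcons_cons nth_rcons ltnn eqxx.
    by rewrite /chain_value nth_default //= st.
  by rewrite nthL //; exact: mono.
apply/mem_chains; split=> // i; first exact: (tk i.+1).
by move=> h; rewrite -nthL //; apply: mono; rewrite size_snake_lower ltnW.
Qed.

(** Sums the step identity of the threshold paths over j < k, with the subtracted term moved across
    to stay in [nat]. *)
Lemma chain_point_coord (R : realType) d k L t (i : 'I_d) : size L = d ->
  chain_value t 0 = 0%N ->
  (forall n, (chain_value t n <= k)%N) ->
  (forall n, (n < size L)%N ->
     if nth false L n then (chain_value t n.+1 <= chain_value t n)%N
     else (chain_value t n <= chain_value t n.+1)%N) ->
  chain_point R d k L t 0 i =
  \sum_(j < k) (nth false (threshold_path L (chain_value t) j) i)%:R.
Proof.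
move=> sL t0 tk mono; have iL : (i < size L)%N by rewrite sL.
rewrite mxE -natr_sum; apply/eqP; rewrite subr_eq -!natrD eqr_nat; apply/eqP.
rewrite -[X in (_ = _ + X)%N](sum_threshold k (chain_value t i) (tk i)) -big_split.
under [RHS]eq_bigr => j _ do rewrite /= nth_threshold_path //.
by rewrite big_split /= sum_threshold // sum_nat_const card_ord.
Qed.

(** Strictly between the ends [U] is strictly above [L], which leaves room for an extra 0 or 1; at
    the ends tau is 0. *)
Lemma threshold_path_snake a tau j : tau 0%N = 0%N ->
  (forall i, (i < size (snake_lower a))%N ->
     if nth false (snake_lower a) i then (tau i.+1 <= tau i)%N
     else (tau i <= tau i.+1)%N) ->
  tau (size (snake_lower a)) = 0%N ->
  [/\ lattice_path (snake_width a) (snake_rank a) (threshold_path (snake_lower a) tau j),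
      never_above (threshold_path (snake_lower a) tau j) (snake_upper a)
    & never_above (snake_lower a) (threshold_path (snake_lower a) tau j)].
Proof.
set L := snake_lower a => tau0 mono taud.
have hT n := height_threshold_path L tau j n tau0 mono.
have sT : size (threshold_path L tau j) = size L by rewrite size_mkseq.
have Lpath := lattice_path_snake_lower a.
have Upath := lattice_path_snake_upper a.
have sU : size (snake_upper a) = size L.
  by rewrite (size_lattice_path Lpath) (size_lattice_path Upath).
have cT : count id (threshold_path L tau j) = count id L.
  by have := hT _ (leqnn _); rewrite !height_size ?sT // taud addn0.
have cU : count id (snake_upper a) = count id L.
  by case/andP: Lpath => _ /eqP ->; case/andP: Upath => _ /eqP.
split.
- case/andP: Lpath => /eqP <- /eqP <-; rewrite /lattice_path cT eqxx andbT.
  (* Equal lengths and equal numbers of vertical steps give equal numbers of horizontal ones. *)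
  rewrite -(eqn_add2l (count id L)) -[in X in X == _]cT.
  by rewrite !(count_predC id) sT.
- move=> i; have [iL|Li] := ltnP i (size L); last by rewrite !height_size ?sT ?sU ?cT ?cU.
  case: i iL => [|i] iL; first by rewrite /height !take0.
  have : (height L i.+1 < height (snake_upper a) i.+1)%N.
    by apply: snake_paths_meet_only_at_ends; rewrite -(size_lattice_path Lpath).
  by rewrite (hT _ (ltnW iL)); case: (j < _)%N; rewrite ?addn1 ?addn0 // => /ltnW.
- move=> i; have [iL|Li] := ltnP i (size L); last by rewrite !height_size ?sT ?cT.
  by rewrite (hT _ (ltnW iL)) leq_addr.
Qed.

(** * The integer points of the dilated polytope of a snake *)

Lemma integer_points_snake (R : realType) k a : (0 < k)%N ->
  integer_points (dilate k (matroid_polytope R (snake_bases a))) =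
  [set` [seq chain_point R _ k (snake_lower a) t
        | t <- chains k (false :: snake_moves a) 0]].
Proof.
move=> k0; set L := snake_lower a; set d := (_ + _)%N.
have sL : size L = d by exact: size_lattice_path (lattice_path_snake_lower a).
have sN : (size (snake_moves a)).+2 = d by rewrite -sL size_snake_lower.
have kR0 : k%:R != 0 :> R by rewrite pnatr_eq0 -lt0n.
rewrite predeqE => x; split=> [[[y Py /= <-] xint]|/mapP[t /mem_snake_chains]].
  (* The excesses tau of the given point, real at first; integrality and the lower bound make them
     natural numbers. *)
  pose S n := prefix_sum (k%:R *: y) n - (k * height L n)%:R.
  have Sbd n : (n <= d)%N -> 0 <= S n <= (k * (height (snake_upper a) n - height L n))%:R.
    move=> nd; have /andP[lo hi] := matroid_polytope_prefix_sum Py nd.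
    rewrite /S prefix_sumZ mulnBr natrB ?leq_mul2l ?never_above_snake ?orbT //.
    by rewrite !natrM subr_ge0 lerD2r !ler_wpM2l ?ler0n.
  have SK n : (n <= d)%N -> (Num.truncn (S n))%:R = S n.
    move=> nd; apply: truncnK; rewrite natrEint (andP (Sbd n nd)).1 andbT.
    by apply: rpredB; [exact: prefix_sum_int | exact: rpred_nat].
  pose t := mkseq (fun n => Num.truncn (S n.+1)) (size (snake_moves a)).+1.
  have st : size t = (size (snake_moves a)).+1 by rewrite size_mkseq.
  have S0 : S 0%N = 0 by rewrite /S prefix_sum0 /height take0 muln0 subrr.
  (* At the end both paths have the same height, so the bounds squeeze the excess to 0. *)
  have Sd : S d = 0.
    apply/eqP; rewrite eq_le andbC; have := Sbd d (leqnn d).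
    case/andP: (lattice_path_snake_lower a) => _ /eqP cL.
    case/andP: (lattice_path_snake_upper a) => _ /eqP cU.
    rewrite !height_size ?cL ?cU ?subnn ?muln0 ?sL //.
    by rewrite (size_lattice_path (lattice_path_snake_upper a)).
  have tS n : (n <= d)%N -> (chain_value t n)%:R = S n.
    case: n => [|n] nd; first by rewrite S0.
    rewrite /chain_value /=; have [nN|Nn] := ltnP n (size (snake_moves a)).+1.
      by rewrite nth_mkseq // SK.
    by rewrite nth_default ?st // (_ : n.+1 = d) ?Sd //; lia.
  have St (i : 'I_d) : (k%:R *: y) 0 i =
      (k * nth false L i)%:R + (chain_value t i.+1)%:R - (chain_value t i)%:R.
    have id := ltn_ord i; have id' := ltnW id.
    rewrite !tS // /S prefix_sumS heightS mulnDr natrD; ring.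
  apply/mapP; exists t; last by apply/rowP=> i; rewrite St mxE.
  apply/mem_snake_chains; split=> // i.
    have [nd|dn] := leqP i d; last first.
      by rewrite /chain_value nth_default // -[size _]/(size t).+1 st sN ltnW.
    rewrite -(ler_nat R) tS //; have /andP[_ /le_trans -> //] := Sbd i nd.
    (* The upper path is at most one unit above the lower one. *)
    rewrite ler_nat -[leqRHS]muln1 leq_mul2l; apply/orP; right.
    case: i nd => [|i] _; first by rewrite /height !take0.
    by rewrite height_snake_upper height_snake_lower; lia.
  (* Coordinates of the dilate lie in [0, k]: the upper bound forces a decrease where [L] steps up,
     the lower bound an increase elsewhere. *)
  rewrite -/L sL => id; have /andP[] := matroid_polytope_coord (Ordinal id) Py.
  rewrite -(ler_pM2l (_ : 0 < k%:R)) ?ltr0n // mulr0 => lo.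
  rewrite -(ler_pM2l (_ : 0 < k%:R)) ?ltr0n // mulr1 => hi.
  have := St (Ordinal id); rewrite mxE /= => e; rewrite e in lo hi.
  case: (nth _ _ _) lo hi {e}; rewrite ?muln1 ?muln0 => lo hi;
  rewrite -(ler_nat R); lra.
move=> [st tk mono ->].
have t0 : chain_value t 0 = 0%N by [].
have td : chain_value t (size L) = 0%N.
  by rewrite sL -sN /chain_value nth_default // -[size (_ :: _)]/(size t).+1 st.
have Tpath j := threshold_path_snake a (chain_value t) j t0 mono td.
split; last first.
  move=> i; rewrite mxE.
  by apply: rpredB; [apply: rpredD |]; exact: rpred_nat.
pose B j := [set i : 'I_d | nth false (threshold_path L (chain_value t) j) i]%SET.
(* The average of the k bases given by the threshold paths. *)
exists (\sum_(j < k) k%:R^-1 *: \sum_(i in B j) delta_mx 0 i).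
  exists k, (fun j : 'I_k => \sum_(i in B j) delta_mx 0 i), (fun=> k%:R^-1); split=> //.
  - move=> j; exists (B j) => //=; apply/mem_lpm_bases.
    by exists (threshold_path L (chain_value t) j); have [] := Tpath j; split.
  - by move=> _; rewrite invr_ge0 ler0n.
  - by rewrite sumr_const card_ord -[LHS]mulr_natr mulVf.
rewrite -scaler_sumr scalerA divff // scale1r; apply/rowP=> i.
rewrite chain_point_coord // summxE; apply: eq_bigr => j _.
by rewrite indicator_coord inE.
Qed.

(** * The number of integer points as a matrix product *)

Theorem theorem3p10 (R : realType) (k a1 : nat) (a : seq nat)
    (hk : (1 <= k)%N) (ha1 : (1 <= a1)%N)
    (ha : forall b : nat, b \in a -> (2 <= b)%N) :
  finite_set (integer_points (dilate k
    (matroid_polytope R (snake_bases (a1 :: a))))) /\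
  #|` fset_set (integer_points (dilate k
    (matroid_polytope R (snake_bases (a1 :: a)))))|%:R =
  ((ones k)^T *m (\prod_(b <- a1 :: a) (snakeA k b *m reversal_mx k))
    *m ones k) 0 0.
Proof.
have pos : {in a1 :: a, forall b, (0 < b)%N}.
  by move=> b; rewrite inE => /orP[/eqP -> //|/ha/ltnW].
rewrite integer_points_snake // -size_snake_chains //.
set C := chains _ _ _; set f := chain_point _ _ _ _.
(* A finite set gives finiteness, and its cardinality is the size of a list without duplicates. *)
have -> : [set` [seq f t | t <- C]] = [set` [fset x in [seq f t | t <- C]]].
  by rewrite predeqE => x; rewrite /= inE.
split; first exact: finite_fset.
rewrite set_fsetK card_fseq undup_id ?size_map // map_inj_in_uniq ?chains_uniq //.
move=> t1 t2 /mem_snake_chains[s1 _ _] /mem_snake_chains[s2 _ _].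
by apply: chain_point_inj; rewrite ?s1 ?s2 // snake_size.
Qed.
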